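(* Let $T_0:[0,1]\to[0,1]$ be Borel measurable and $\rho$ a Lipschitz probability density on $\mathbb R$ supported on $[-1,1]$. Suppose the transfer operator $L_0:L^2([0,1],\mathbb C)\to L^2([0,1],\mathbb C)$, $L_0f(x)=\int k_0(x,y)f(y)\,dy$ with $k_0(x,y)=(P_\pi\tau_{-T_0(y)}\rho)(x)$, satisfies (A1): $\lim_{n\to\infty}\|L_0^ng\|_2=0$ for every $g$ with $\int g\,dm=0$. Let $\lambda_0$ be an eigenvalue of $L_0$ of largest magnitude strictly inside the unit disk, suppose $\lambda_0$ is geometrically simple, and let $e$ and $\hat e$ be eigenvectors of $L_0$ and $L_0^*$, respectively, for the eigenvalue $\lambda_0$. Put $$E(x,y):=\big(\Re(\hat e)(x)\Re(e)(y)+\Im(\hat e)(x)\Im(e)(y)\big)\Re(\lambda_0)+\big(\Im(\hat e)(x)\Re(e)(y)-\Re(\hat e)(x)\Im(e)(y)\big)\Im(\lambda_0).$$ Let $\ell\ge0$ and suppose there is $F'\subset\widetilde F_\ell$ with $m(F')>0$ and $E(\cdot,y)\notin\mathrm{span}\{\mathcal P(\cdot,y)\}^\perp$ for all $y\in F'$. Then the problem $$\min_{\dot T\in S_{T_0,\ell}}\langle\dot T,\widehat E\rangle_{L^2([0,1],\mathbb R)}\quad\text{such that}\quad\|\dot T\|_2^2-1=0$$ has the unique solution $$\dot T(y)=\begin{cases}\dfrac1\alpha\displaystyle\int_0^1\left(P_\pi\left(\tau_{-T_0(y)}\frac{d\rho}{dx}\right)\right)(x)E(x,y)\,dx&y\in\widetilde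 F_\ell,\\[2mm]0&\text{otherwise},\end{cases}$$ where $\alpha>0$ is selected so that $\|\dot T\|_2=1$. Furthermore, $\dot T\in L^\infty$.
   Context: $L^p=L^p([0,1],\mathbb R)$ with Lebesgue measure $m$. $(\tau_bg)(x):=g(x+b)$; $P_\pi f(x):=\sum_{i\in2\mathbb Z}(f(i+x)+f(i-x))$ for $x\in[0,1]$. $d\rho/dx$ is the a.e. derivative and $\mathcal P(x,y):=\left(P_\pi\left(\tau_{-T_0(y)}\frac{d\rho}{dx}\right)\right)(x)$. $L_0^*g(y)=\int k_0(x,y)g(x)\,dx$. $\widehat E(y):=-\int_0^1\mathcal P(x,y)E(x,y)\,dx$. $\widetilde F_\ell:=\{x\in[0,1]:\ell\le T_0(x)\le1-\ell\}$; $S_{T_0,\ell}:=\{T\in L^2:\mathrm{supp}(T)\subseteq\widetilde F_\ell\}$ (i.e. $T=0$ a.e. outside $\widetilde F_\ell$). Orthogonality is in $L^2$. *)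

(* Defs.v *)
From mathcomp Require Import all_boot all_order all_algebra.
From mathcomp Require Import all_classical all_reals all_analysis.
From mathcomp Require Import complex.

Set Implicit Arguments.
Unset Strict Implicit.
Unset Printing Implicit Defensive.
Import Order.TTheory GRing.Theory Num.Theory.
Import numFieldNormedType.Exports.

Local Open Scope classical_set_scope.
Local Open Scope ring_scope.
Local Open Scope complex_scope.

Definition unitI (R : realType) : set R := `[0, 1]%classic.
Arguments unitI : clear implicits.

(* Functions on [0, 1] are represented by total functions on R; only their
   values on [0, 1] are constrained or used, hence the restrictions f \_ unitI
   (f on [0, 1], 0 outside) below. *)
Definition Lp01 (R : realType) (p : \bar R) : set (R -> R) :=
  [set f : R -> R | (f \_ (unitI R)) \in Lfun (@lebesgue_measure R) p].

Definition norm2 (R : realType) (f : R -> R) : \bar R :=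
  'N[@lebesgue_measure R]_(2%:E)[EFin \o (f \_ (unitI R))]%E.

Definition inner2 (R : realType) (f g : R -> R) : R :=
  \int[@lebesgue_measure R]_(x in unitI R) (f x * g x).

Definition ae_eq01 (R : realType) (V : Type) (f g : R -> V) : Prop :=
  {ae (@lebesgue_measure R), forall x, unitI R x -> f x = g x}.

Definition span1 (R : realType) (g : R -> R) : set (R -> R) :=
  [set h | exists c : R, h = (fun x => c * g x)].

Definition orth_compl (R : realType) (A : set (R -> R)) : set (R -> R) :=
  [set f | Lp01 2%:E f /\ forall g, A g -> inner2 f g = 0].

Definition L2C (R : realType) : set (R -> R[i]) :=
  [set f | Lp01 2%:E (fun x => complex.Re (f x)) /\
           Lp01 2%:E (fun x => complex.Im (f x))].

Definition norm2C (R : realType) (f : R -> R[i]) : \bar R :=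
  norm2 (fun x => ComplexField.Normc.normc (f x)).

Definition intC (R : realType) (f : R -> R[i]) : R[i] :=
  (\int[@lebesgue_measure R]_(x in unitI R) complex.Re (f x)) +i*
  (\int[@lebesgue_measure R]_(x in unitI R) complex.Im (f x)).

Definition is_eigenvector (R : realType) (L : (R -> R[i]) -> (R -> R[i]))
    (mu : R[i]) (f : R -> R[i]) : Prop :=
  [/\ L2C f, ~ ae_eq01 f (fun=> 0) & ae_eq01 (L f) (fun x => mu * f x)].

Definition is_eigenvalue (R : realType) (L : (R -> R[i]) -> (R -> R[i]))
    (mu : R[i]) : Prop :=
  exists f, is_eigenvector L mu f.

Definition geometrically_simple (R : realType)
    (L : (R -> R[i]) -> (R -> R[i])) (mu : R[i]) : Prop :=
  exists2 v, is_eigenvector L mu v &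
    forall f, is_eigenvector L mu f ->
      exists c : R[i], ae_eq01 f (fun x => c * v x).

Definition largest_inner_eigenvalue (R : realType)
    (L : (R -> R[i]) -> (R -> R[i])) (lambda : R[i]) : Prop :=
  [/\ is_eigenvalue L lambda, `|lambda| < 1 &
      forall mu, is_eigenvalue L mu -> `|mu| < 1 -> `|mu| <= `|lambda|].

Definition lipschitz_density (R : realType) (rho : R -> R) : Prop :=
  [/\ exists k : R, k.-lipschitz rho,
      forall x, 0 <= rho x,
      (\int[@lebesgue_measure R]_x (rho x)%:E = 1)%E &
      closure [set x | rho x != 0] `<=` `[-1, 1]].

Definition translate (R : realType) (b : R) (g : R -> R) : R -> R :=
  fun x => g (x + b).

(* \sum_(i \in A) sums the finitely many nonzero terms; P_pi is only applied
   to compactly supported functions, for which this is the full series. *)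
Definition P_pi (R : realType) (f : R -> R) : R -> R :=
  fun x => \sum_(i \in [set i : int | (2 %| i)%Z])
             (f (i%:~R + x) + f (i%:~R - x)).

Definition k0 (R : realType) (T0 rho : R -> R) (x y : R) : R :=
  P_pi (translate (- T0 y) rho) x.

Definition L0 (R : realType) (T0 rho : R -> R) (f : R -> R[i]) : R -> R[i] :=
  fun x => intC (fun y => (k0 T0 rho x y)%:C * f y).

(* The kernel k0 is real, so no conjugation is needed in the adjoint. *)
Definition L0_adj (R : realType) (T0 rho : R -> R) (g : R -> R[i]) :
    R -> R[i] :=
  fun y => intC (fun x => (k0 T0 rho x y)%:C * g x).

Definition condA1 (R : realType) (T0 rho : R -> R) : Prop :=
  forall g : R -> R[i], L2C g -> intC g = 0 ->
    norm2C (iter n (L0 T0 rho) g) @[n --> \oo] --> 0%E.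

(* derive1 rho is the pointwise derivative where it exists, that is almost
   everywhere for Lipschitz rho, and a default value elsewhere. *)
Definition calP (R : realType) (T0 rho : R -> R) (x y : R) : R :=
  P_pi (translate (- T0 y) (derive1 rho)) x.

Definition kerE (R : realType) (lambda0 : R[i]) (e ehat : R -> R[i])
    (x y : R) : R :=
  (complex.Re (ehat x) * complex.Re (e y) +
   complex.Im (ehat x) * complex.Im (e y)) * complex.Re lambda0 +
  (complex.Im (ehat x) * complex.Re (e y) -
   complex.Re (ehat x) * complex.Im (e y)) * complex.Im lambda0.

Definition Ehat (R : realType) (T0 rho : R -> R) (E : R -> R -> R) : R -> R :=
  fun y => - \int[@lebesgue_measure R]_(x in unitI R)
               (calP T0 rho x y * E x y).

Definition Ftilde (R : realType) (T0 : R -> R) (l : R) : set R :=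
  [set x | unitI R x /\ l <= T0 x <= 1 - l].

Definition S_T0 (R : realType) (T0 : R -> R) (l : R) : set (R -> R) :=
  [set T | Lp01 2%:E T /\
           {ae (@lebesgue_measure R),
              forall x, unitI R x -> ~ Ftilde T0 l x -> T x = 0}].

Definition feasible (R : realType) (T0 : R -> R) (l : R) : set (R -> R) :=
  [set T | S_T0 T0 l T /\ (norm2 T ^+ 2 - 1 = 0)%E].

Definition minimizer (R : realType) (A : set (R -> R)) (J : (R -> R) -> R)
    (T : R -> R) : Prop :=
  A T /\ forall T', A T' -> J T <= J T'.

Definition unique_minimizer (R : realType) (A : set (R -> R))
    (J : (R -> R) -> R) (T : R -> R) : Prop :=
  minimizer A J T /\ forall T', minimizer A J T' -> ae_eq01 T' T.

Definition Tdot (R : realType) (T0 rho : R -> R) (E : R -> R -> R)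
    (l alpha : R) : R -> R :=
  fun y => if y \in Ftilde T0 l then
             1 / alpha *
             \int[@lebesgue_measure R]_(x in unitI R)
               (P_pi (translate (- T0 y) (derive1 rho)) x * E x y)
           else 0.

(* Main.v *)
Require Import Defs.
From mathcomp Require Import all_boot all_order all_algebra.
From mathcomp Require Import all_classical all_reals all_analysis measurable_realfun.
From mathcomp Require Import complex ring lra zify.

Set Implicit Arguments.
Unset Strict Implicit.
Unset Printing Implicit Defensive.
Import Order.TTheory GRing.Theory Num.Theory.
Import numFieldNormedType.Exports.

Local Open Scope classical_set_scope.
Local Open Scope ring_scope.
Local Open Scope complex_scope.

(** On the functions vanishing outside F = [Ftilde T0 l] the objective is
    T |-> - <T, g>, where g is the restriction of - [Ehat] to F, so that for unit
    vectors the expansion of |T - g/|g||^2 identifies the minimizer g/|g|.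
    What has to be checked is that g is measurable, essentially bounded and not
    a.e. zero.  Since e = (L0 e)/lambda0 and the kernel of [L0] is bounded, e is
    essentially bounded, hence so is g; lambda0 <> 0 because otherwise E = 0 would
    contradict the hypothesis on F', and the latter says precisely that g does
    not vanish on F'. *)

(** * Measurability, boundedness and support of the pointwise derivative *)

Section derive1_lipschitz.
Context {R : realType}.
Implicit Types f : R -> R.

Local Notation quot f x := (fun h => h^-1 *: (f (h + x) - f x)).

Let uniformly_close f (k n : nat) : set R :=
  \bigcap_(p in [set p : R * R | [/\ p.1 != 0, p.2 != 0,
      `|p.1| < n.+1%:R^-1 & `|p.2| < n.+1%:R^-1]])
    [set x | `|quot f x p.1 - quot f x p.2| <= k.+1%:R^-1].

Let closed_uniformly_close f k n : continuous f ->
  closed (uniformly_close f k n).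
Proof.
move=> cf; apply: closed_bigI => -[h h'] _ /=.
have cq (a : R) : continuous (fun x : R => quot f x a).
  move=> x; apply: cvgZr; apply: cvgB; last exact: cf.
  apply: continuous_comp; last exact: cf.
  by apply: cvgD; [exact: cvg_cst|exact: cvg_id].
apply: (@preimage_closed _ _ (fun x : R => `|quot f x h - quot f x h'|)
   [set y | y <= k.+1%:R^-1]); last exact: closed_le.
move=> x _; apply: cvg_norm; apply: cvgB; exact: cq.
Qed.

Let derivable_setE f :
  [set x | cvg (quot f x @ 0^')] =
  \bigcap_k \bigcup_n uniformly_close f k n.
Proof.
apply/seteqP; split=> x /=.
- move=> /cvg_ex[/= l xl] k _.
  have k0 : 0 < k.+1%:R^-1 / 2 :> R by rewrite divr_gt0 ?invr_gt0.
  move/cvgrPdist_lt : xl => /(_ _ k0).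
  rewrite near_withinE => /nbhs_ballP[d /= d0 dk].
  have [n nd] : exists n, n.+1%:R^-1 < d.
    by have [n _ nd] := near_infty_natSinv_lt (PosNum d0); exists n; exact: (nd n (leqnn _)).
  exists n => // -[h h'] /= [h0 h'0 hn h'n].
  have A a : a != 0 -> `|a| < n.+1%:R^-1 -> `|l - quot f x a| < k.+1%:R^-1 / 2.
    move=> a0 an; apply: dk => //=.
    by rewrite /ball/= sub0r normrN (lt_trans an).
  rewrite -(subrK l (h^-1 *: _)) -addrA (le_trans (ler_normD _ _))//.
  rewrite [leRHS]splitr lerD// ltW//; last exact: A.
  by rewrite distrC; exact: A.
(* Conversely, the quotients with increments below 1/(n+1) form a set of diameter at most 1/(k+1),
   so the image filter is Cauchy and completeness of the reals gives the limit. *)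
- move=> H; apply: cauchy_cvg; apply/cauchy_ballP => e e0 /=.
  have [k ke] : exists k, k.+1%:R^-1 < e.
    by have [n _ nd] := near_infty_natSinv_lt (PosNum e0); exists n; exact: (nd n (leqnn _)).
  have [n _ Hn] := H k I.
  have B : \forall h \near 0^', h != 0 :> R /\ `|h| < n.+1%:R^-1 :> R.
    rewrite near_withinE; apply/nbhs_ballP; exists n.+1%:R^-1 => /=.
      by rewrite invr_gt0.
    by move=> h /=; rewrite /ball/= sub0r normrN.
  exists (quot f x @` [set h | h != 0 /\ `|h| < n.+1%:R^-1],
          quot f x @` [set h | h != 0 /\ `|h| < n.+1%:R^-1]).
    by split; apply: filterS B => h /= ?; exists h.
  move=> [_ _] [/= [h [h0 hn] <-] [h' [h'0 h'n] <-]]; rewrite /ball/=.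
  by rewrite (le_lt_trans _ ke)//; exact: (Hn (h, h')).
Qed.

(* By the Cauchy criterion the set of points of differentiability is a countable
   intersection of countable unions of the sets [uniformly_close f k n], which are
   closed, being intersections of closed conditions over all the increments. *)
Lemma measurable_derive1 f : continuous f -> measurable_fun setT (derive1 f).
Proof.
move=> cf; set D := [set x | cvg (quot f x @ 0^')].
have mD : measurable D.
  rewrite /D derivable_setE; apply: bigcap_measurable; first by exists 0%N.
  move=> k _; apply: bigcup_measurable => n _.
  by apply: (@closed_measurable R); exact: closed_uniformly_close.
(* Off [D] the derivative is the constant default value [point]; on [D] it is the pointwise limit of
   the continuous difference quotients with increments 1/(n+1). *)
have -> : derive1 f = fun x => if x \in D then derive1 f x else point.
  apply/funext => x; case: ifPn => // /negP Dx; rewrite /derive1 dvgP//.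
  by move=> xD; apply: Dx; rewrite inE.
apply: measurable_fun_if => //.
- by apply: (measurable_fun_bool true); rewrite setTI preimage_mem_true.
- rewrite setTI preimage_mem_true.
  apply: (measurable_fun_cvg (h := fun n (x : R) => quot f x n.+1%:R^-1)).
    move=> n; apply: measurable_funTS; apply: continuous_measurable_fun => x.
    apply: cvgZr; apply: cvgB; last exact: cf.
    apply: continuous_comp; last exact: cf.
    by apply: cvgD; [exact: cvg_cst|exact: cvg_id].
  move=> x Dx.
  apply: (@cvg_comp _ _ _ (fun n => n.+1%:R^-1) (quot f x) _ 0^'); last exact: Dx.
  move=> A; rewrite /= /dnbhs /within /= => /nbhs_ballP[d /= d0 dA].
  have := near_infty_natSinv_lt (PosNum d0); apply: filterS => n /= nd.
  apply: dA => /=; last by rewrite invr_neq0.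
  by rewrite /ball/= sub0r normrN gtr0_norm ?invr_gt0.
Qed.

Lemma derive1_lipschitz_bounded (k : R) f : k.-lipschitz f ->
  exists M : R, forall x, `|derive1 f x| <= M.
Proof.
move=> kf.
(* [point] is the junk value of [derive1] where the limit does not exist. *)
exists (Num.max k `|point : R|) => x.
have [xD|xD] := pselect (cvg (quot f x @ 0^')); last first.
  by rewrite /derive1 dvgP// le_max lexx orbT.
rewrite le_max; apply/orP; left.
(* All difference quotients have modulus at most k, a closed condition, which therefore passes to
   the limit. *)
apply: (@closed_cvg _ _ _ _ _ [set y : R | `|y| <= k] _ _ _ xD).
  apply: (@preimage_closed _ _ (fun y : R => `|y|) [set y | y <= k]); last exact: closed_le.
  by move=> y _; exact: norm_continuous.
rewrite near_withinE; near=> h => h0 /=.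
rewrite normrZ normfV ler_pdivrMl ?normr_gt0// mulrC.
have := kf (h + x, x) (conj I I) => /=.
by rewrite addrK.
Unshelve. all: by end_near. Qed.

(** Since [A] is closed, f vanishes on a whole neighbourhood of any point outside [A]. *)
Lemma derive1_supp f (A : set R) : closed A -> (forall x, ~ A x -> f x = 0) ->
  forall x, ~ A x -> derive1 f x = 0.
Proof.
move=> cA f0 x Ax; rewrite derive1E.
rewrite (@near_eq_derive _ _ _ f (cst 0)) ?derive_cst//.
have : nbhs x (~` A) by apply: open_nbhs_nbhs; split => //; exact: closed_openC.
by apply: filterS => y /f0.
Qed.

End derive1_lipschitz.

(** * Unit vectors of $L^2$ and essentially bounded functions *)

Section Lfun_lemmas.
Context d (T : measurableType d) (R : realType).
Variable mu : {measure set T -> \bar R}.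
Implicit Types f g : T -> R.

Lemma Lfun_measurable p f : f \in Lfun mu p -> measurable_fun setT f.
Proof. by move=> /sub_Lfun_mfun; rewrite inE. Qed.

Lemma Lfun2_mul_integrable f g : f \in Lfun mu 2%:E -> g \in Lfun mu 2%:E ->
  mu.-integrable setT (EFin \o (fun x => f x * g x)).
Proof. by move=> lf lg; apply/Lfun1_integrable/Lfun2_mul_Lfun1. Qed.

Lemma Lnorm2_eq1 f : f \in Lfun mu 2%:E ->
  ('N[mu]_2%:E[EFin \o f] = 1)%E <-> \int[mu]_x (f x * f x) = 1.
Proof.
move=> lf; have N0 := Lnorm_ge0 mu 2%:E (EFin \o f).
have fin : (\int[mu]_x (f x * f x)%:E)%E \is a fin_num.
  exact: integrable_fin_num (Lfun2_mul_integrable lf lf).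
have NE : ('N[mu]_2%:E[EFin \o f] `^ 2 = (\int[mu]_x (f x * f x))%:E)%E.
  rewrite poweR_Lnorm// /Rintegral fineK//; apply: eq_integral => x _ /=.
  by rewrite powR_mulrn// real_normK// ?num_real// expr2.
split=> [N1|I1].
- by apply: EFin_inj; rewrite -NE N1 poweR1r.
(* The norm is nonnegative, hence recovered as the power 1/2 of its square. *)
- have -> : ('N[mu]_2%:E[EFin \o f] = 'N[mu]_2%:E[EFin \o f] `^ (2 * 2^-1))%E.
    by rewrite mulfV// poweRe1.
  by rewrite poweRrM NE I1 poweR1r.
Qed.

(** For unit vectors $\int (f-g)^2 = 2 - 2\int fg$. Nonnegativity of the left side gives the bound;
    in the equality case the left side vanishes, which forces f = g a.e. *)
Lemma Lfun2_dot_le1 f g : f \in Lfun mu 2%:E -> g \in Lfun mu 2%:E ->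
  \int[mu]_x (f x * f x) = 1 -> \int[mu]_x (g x * g x) = 1 ->
  \int[mu]_x (f x * g x) <= 1 /\
  (1 <= \int[mu]_x (f x * g x) -> {ae mu, forall x, f x = g x}).
Proof.
move=> lf lg f1 g1.
have iff := Lfun2_mul_integrable lf lf.
have igg := Lfun2_mul_integrable lg lg.
have ifg := Lfun2_mul_integrable lf lg.
have i2fg : mu.-integrable setT (EFin \o (fun x => 2 * (f x * g x))).
  exact: (integrableZl measurableT 2 ifg).
have iD : mu.-integrable setT (EFin \o (fun x => f x * f x + g x * g x)).
  exact: (integrableD measurableT iff igg).
have sqE x : (f x - g x) ^+ 2 = f x * f x + g x * g x - 2 * (f x * g x).
  by ring.
have isq : mu.-integrable setT (EFin \o (fun x => (f x - g x) ^+ 2)).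
  by rewrite (funext sqE); exact: (integrableB measurableT iD i2fg).
have dE : \int[mu]_x ((f x - g x) ^+ 2) = 2 - 2 * \int[mu]_x (f x * g x).
  under eq_Rintegral do rewrite sqE.
  by rewrite RintegralB// RintegralD// f1 g1 RintegralZl.
have d0 : 0 <= \int[mu]_x ((f x - g x) ^+ 2).
  by apply: Rintegral_ge0 => x _; exact: sqr_ge0.
split=> [|fg1]; first by lra.
have D0 : \int[mu]_x ((f x - g x) ^+ 2) = 0 by lra.
have : (\int[mu]_x `|((f x - g x) ^+ 2)%:E| = 0)%E.
  under eq_integral do rewrite gee0_abs ?lee_fin ?sqr_ge0//.
  by rewrite -[LHS]fineK ?[fine _]D0//; exact: integrable_fin_num isq.
move/ae_eq_integral_abs => /(_ measurableT (measurable_int _ isq)).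
apply: filterS => x /= /(_ I) [] /eqP.
by rewrite sqrf_eq0 subr_eq0 => /eqP.
Qed.

Lemma ae_bounded_Lfun (D : set T) (C : R) f : measurable D -> (mu D < +oo)%E ->
  measurable_fun setT f -> (forall x, ~ D x -> f x = 0) ->
  {ae mu, forall x, `|f x| <= C} ->
  f \in Lfun mu 2%:E /\ f \in Lfun mu +oo%E.
Proof.
move=> mD Dfin mf f0 fC; split; rewrite inE; apply/andP; split;
  rewrite inE//= /finite_norm unlock.
- rewrite poweR_lty//.
  apply: (@le_lt_trans _ _ (\int[mu]_x ((C ^+ 2) * \1_D x)%:E)%E).
    apply: ae_ge0_le_integral => //=.
    + apply/measurable_EFinP.
      apply: (measurableT_comp (measurable_powR _)) => //.
      exact: measurableT_comp.
    + by move=> x _; rewrite lee_fin mulr_ge0 ?sqr_ge0.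
    + by apply/measurable_EFinP; apply: measurable_funM => //.
    + apply: filterS fC => x fxC _; rewrite lee_fin powR_mulrn//.
      have [xD|xD] := boolP (x \in D); rewrite indicE.
        (* Squaring the bound requires 0 <= C, which follows from 0 <= |f x| <= C at this very
           point. *)
        by rewrite xD mulr1 lerXn2r// nnegrE// (le_trans _ fxC).
      rewrite (negbTE xD) mulr0 f0 ?normr0 ?expr0n//.
      by move=> Dx; move/negP: xD; rewrite inE.
  under eq_integral do rewrite EFinM.
  rewrite ge0_integralZl_EFin ?sqr_ge0//; last exact/measurable_EFinP.
  by rewrite integral_indic// setIT lte_mul_pinfty// lee_fin sqr_ge0.
- case: ifPn => // _; apply: (@le_lt_trans _ _ C%:E); last exact: ltry.
  by apply/ess_sup_inf.ess_supP; apply: filterS fC => x /=; rewrite lee_fin.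
Qed.

End Lfun_lemmas.

(** * Measurability and bounds for integrals depending on a parameter *)

Section parametric_Rintegral.
Context d1 d2 (T1 : measurableType d1) (T2 : measurableType d2) (R : realType).
Variable mu : {sigma_finite_measure set T1 -> \bar R}.

(** Tonelli applies to the positive and negative parts separately, so the conclusion covers
    parameters with a non-integrable section too: there [fine] still acts measurably on the
    difference. *)
Lemma measurable_parametric_Rintegral (F : T1 * T2 -> R) :
  measurable_fun setT F ->
  measurable_fun setT (fun y => \int[mu]_x F (x, y)).
Proof.
move=> mF; rewrite /Rintegral; apply: measurableT_comp => //.
under eq_fun do rewrite integralE.
have mEF : measurable_fun setT (EFin \o F) by exact/measurable_EFinP.
apply: emeasurable_funB.
- have := measurable_fun_fubini_tonelli_G (m1 := mu) (EFin \o F)^\+%E.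
  move=> /(_ (measurable_funepos mEF) (fun=> funepos_ge0 _ _)).
  by apply: eq_measurable_fun => y _; apply: eq_integral => x _; rewrite !funeposE.
- have := measurable_fun_fubini_tonelli_G (m1 := mu) (EFin \o F)^\-%E.
  move=> /(_ (measurable_funeneg mEF) (fun=> funeneg_ge0 _ _)).
  by apply: eq_measurable_fun => y _; apply: eq_integral => x _; rewrite !funenegE.
Qed.

End parametric_Rintegral.

Lemma normr_Rintegral_le d (T : measurableType d) (R : realType)
  (mu : {measure set T -> \bar R}) (f g : T -> R) : measurable_fun setT f ->
  mu.-integrable setT (EFin \o g) -> (forall x, `|f x| <= g x) ->
  `|\int[mu]_x f x| <= \int[mu]_x g x.
Proof.
move=> mf ig fg; have if_ : mu.-integrable setT (EFin \o f).
  apply: le_integrable ig => //=; first exact/measurable_EFinP.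
  by move=> x _; rewrite lee_fin (le_trans (fg x))// ler_norm.
rewrite (le_trans (le_normr_Rintegral measurableT if_))// le_Rintegral//.
exact: integrable_norm.
Qed.

(** * The reflected periodized kernel as a finite sum *)

Section folded_kernel.
Context {R : realType}.
Implicit Types (f : R -> R) (x y t M : R).

(* The part of the series [P_pi (translate (- t) f) x] that can be nonzero when
   f is supported in [-1, 1] and x, t are in [0, 1]. *)
Definition folded f x t : R :=
  \sum_(i <- [:: (-2)%Z; 0; 2%Z]) (f (i%:~R + x - t) + f (i%:~R - x - t)).

Lemma P_pi_translateE f x t : (forall s, 1 < `|s| -> f s = 0) ->
  unitI R x -> unitI R t -> P_pi (translate (- t) f) x = folded f x t.
Proof.
move=> f0; rewrite /unitI /= !in_itv /= => /andP[x0 x1] /andP[t0 t1].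
rewrite /P_pi /folded (fsbigE [:: (-2)%Z; 0; 2%Z])//=.
- rewrite !big_cons !big_nil.
  by do 3 (rewrite ifT; last by rewrite inE).
- by move=> i /=; rewrite !inE => /or3P[] /eqP ->.
- move=> i /= /dvdzP[j ->]; rewrite !inE !negb_or => /and3P[j1 j2 j3].
  (* A remaining even index has modulus at least 4. As x and t lie in [0, 1], both arguments of f
     then have modulus at least 2, outside the support. *)
  have [jge|jle] : (4 <= j * 2)%R \/ (j * 2 <= -4)%R by lia.
  + have : (4 : R) <= (j * 2)%:~R by rewrite -[4 : R]/(4%:~R) ler_int.
    move=> h; rewrite /translate !f0 ?addr0// ltr_normr; apply/orP; left; lra.
  + have : (j * 2)%:~R <= (-4 : R).
      by rewrite -[-4 : R]/((-4)%:~R) ler_int.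
    move=> h; rewrite /translate !f0 ?addr0// ltr_normr; apply/orP; right; lra.
Qed.

(** The factor 6 counts two terms for each of the three indices. *)
Lemma folded_bounded f M x t : (forall s, `|f s| <= M) ->
  `|folded f x t| <= 6 * M.
Proof.
move=> fM; rewrite /folded.
rewrite (le_trans (ler_norm_sum _ _ _))// !big_cons !big_nil addr0.
have pairM s s' : `|f s + f s'| <= M + M.
  by rewrite (le_trans (ler_normD _ _))// lerD.
set u := `|_|; set v := `|_|; set w := `|_|.
have := pairM ((-2)%:~R + x - t) ((-2)%:~R - x - t).
have := pairM (0%:~R + x - t) (0%:~R - x - t).
have := pairM (2%:~R + x - t) (2%:~R - x - t).
rewrite -/u -/v -/w; lra.
Qed.

Lemma measurable_folded f (T : R -> R) : measurable_fun setT f ->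
  measurable_fun setT T ->
  measurable_fun setT (fun p : R * R => folded f p.1 (T p.2)).
Proof.
move=> mf mT; rewrite /folded.
under eq_fun do rewrite !big_cons big_nil.
have mTp : measurable_fun setT (fun p : R * R => T p.2).
  exact: measurableT_comp.
have mp (i : R) : measurable_fun setT
    (fun p : R * R => f (i + p.1 - T p.2) + f (i - p.1 - T p.2)).
  apply: measurable_funD; apply: (measurableT_comp mf);
    apply: measurable_funB => //.
  - exact: measurable_funD.
  - exact: measurable_funB.
by apply: measurable_funD => //; apply: measurable_funD => //;
  apply: measurable_funD.
Qed.

End folded_kernel.

(** * The transfer operator on the unit interval and its eigenvectors *)

Section unit_interval.
Context {R : realType}.
Notation mu := (@lebesgue_measure R).

Lemma lebesgue_aeS (P Q : R -> Prop) : (forall x, P x -> Q x) ->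
  {ae mu, forall x, P x} -> {ae mu, forall x, Q x}.
Proof. exact: (@filterS _ _ (ae_filter_ringOfSetsType mu)). Qed.

Lemma measurable_unitI : measurable (unitI R).
Proof. exact: measurable_itv. Qed.

Lemma lebesgue_measure_unitI_fin : (mu (unitI R) < +oo)%E.
Proof. by rewrite /unitI lebesgue_measure_itv /= lte_fin ltr01 -EFinD ltry. Qed.

(** The inclusion of $L^2$ in $L^1$ on a set of finite measure: the function is multiplied by the
    indicator of [0, 1], which is itself in $L^2$. *)
Lemma Lp01_2_integrable (f : R -> R) : Lp01 2%:E f ->
  mu.-integrable setT (EFin \o (f \_ (unitI R))).
Proof.
move=> Lf.
have [|||||L1 _] := @ae_bounded_Lfun _ _ _ mu (unitI R) 1 \1_(unitI R).
  - exact: measurable_unitI.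
  - exact: lebesgue_measure_unitI_fin.
  - by apply: measurable_indic; exact: measurable_unitI.
  - by move=> x xI; rewrite indicE memNset.
  - by apply: aeW => x; rewrite indicE; case: (_ \in _); rewrite ?normr1 ?normr0.
apply: eq_integrable (Lfun2_mul_integrable Lf L1) => // x _ /=.
by rewrite indicE patchE; case: ifP => xI; rewrite ?mulr1 ?mulr0.
Qed.

(** The bound does not depend on x: an integral operator with bounded kernel sends integrable
    functions to bounded ones. *)
Lemma Rintegral_kernel_le (K : R * R -> R) N (u : R -> R) x :
  measurable_fun setT K -> (forall p, `|K p| <= N) ->
  mu.-integrable setT (EFin \o u) ->
  `|\int[mu]_y (K (x, y) * u y)| <= \int[mu]_y (N * `|u y|).
Proof.
move=> mK KN iu; apply: normr_Rintegral_le.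
- apply: measurable_funM.
    exact: (measurableT_comp mK (pair1_measurable x)).
  by apply/measurable_EFinP; exact: measurable_int iu.
- exact: (integrableZl measurableT N (integrable_norm iu)).
- by move=> y; rewrite normrM ler_wpM2r.
Qed.

Variables (T0 rho : R -> R).
Hypotheses (mT0 : measurable_fun (unitI R) T0)
  (T01 : forall x, unitI R x -> unitI R (T0 x)).

(** [T0] is constrained only on [0, 1]; its extension by zero is measurable on the whole line, as
    joint measurability of the kernels demands. *)
Let T := T0 \_ (unitI R).

Let mT : measurable_fun setT T.
Proof. by apply/(measurable_restrictT _ measurable_unitI). Qed.

(** General in f so as to serve both [k0], with f = [rho], and [calP], with f = [derive1 rho]. *)
Lemma transfer_kernelE f x y : (forall s, 1 < `|s| -> f s = 0) ->
  unitI R x -> unitI R y ->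
  P_pi (translate (- T0 y) f) x = folded f x (T y).
Proof.
move=> f0 xI yI; rewrite P_pi_translateE//; last exact: T01.
by rewrite /T patchE mem_set.
Qed.

Hypothesis rhoL : lipschitz_density rho.

Let rho0 s : 1 < `|s| -> rho s = 0.
Proof.
case: rhoL => _ _ _ supp s1; apply: contrapT => /eqP s0.
have := supp s (@subset_closure _ [set x | rho x != 0] s s0).
by rewrite /= in_itv /= -ler_norml leNgt s1.
Qed.

Let drho0 s : 1 < `|s| -> derive1 rho s = 0.
Proof.
move=> s1; apply: (@derive1_supp _ _ `[-1, 1]%classic); first exact: itv_closed.
  move=> x /= xI; apply: rho0; move: xI.
  by rewrite in_itv /= -ler_norml => /negP; rewrite -ltNge.
by rewrite /= in_itv /= -ler_norml; apply/negP; rewrite -ltNge.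
Qed.

Let rho_continuous : continuous rho.
Proof.
case: rhoL => -[k kL] _ _ _ x.
apply/cvgrPdist_lt => e e0.
(* The Lipschitz constant may be 0, whereas this one serves as a divisor. *)
have k1 : 0 < `|k| + 1 by rewrite ltr_wpDl.
near=> y.
have := kL (x, y) (conj I I) => /= /le_lt_trans; apply.
rewrite (@le_lt_trans _ _ ((`|k| + 1) * `|x - y|))//.
  by rewrite ler_wpM2r// (le_trans (ler_norm _))// lerDl.
rewrite -ltr_pdivlMl// mulrC.
near: y; apply: cvgr_dist_lt => //; last by rewrite divr_gt0.
Unshelve. all: by end_near. Qed.

Let rho_bounded : exists M : R, forall s, `|rho s| <= M.
Proof.
case: rhoL => -[k kL] _ _ _.
have k0 : 0 <= k.
  by have := kL (1, 0) (conj I I) => /=; rewrite subr0 normr1 mulr1; exact: le_trans.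
(* For |s| <= 1 compare with the point 2, where [rho] vanishes: it is at distance at most 3 from
   s. *)
exists (k * 3) => s; have [s1|s1] := ltP 1 `|s|.
  by rewrite rho0// normr0 mulr_ge0.
have := kL (s, 2) (conj I I) => /=.
rewrite (rho0 (s := 2)) ?subr0; last by rewrite ger0_norm// ltr1n.
move=> /le_trans; apply; rewrite ler_wpM2l// (le_trans (ler_normB _ _))//.
by rewrite (ger0_norm (x := 2))//; lra.
Qed.

Lemma eigenvector_ess_bounded (lambda : R[i]) (e : R -> R[i]) : lambda != 0 ->
  is_eigenvector (L0 T0 rho) lambda e ->
  exists C : R, {ae mu, forall x, unitI R x ->
    `|complex.Re (e x)| <= C /\ `|complex.Im (e x)| <= C}.
Proof.
move=> l0 [[Lr Li] _ eE].
have [M rhoM] := rho_bounded.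
pose K p := folded rho p.1 (T p.2).
have mK : measurable_fun setT K.
  by apply: measurable_folded => //; exact: continuous_measurable_fun.
have KM p : `|K p| <= 6 * M by exact: folded_bounded.
(* The kernel is real, so [L0] acts separately on real and imaginary parts. *)
have L0E x : unitI R x -> L0 T0 rho e x =
    (\int[mu]_y (K (x, y) * ((fun x => complex.Re (e x)) \_ (unitI R)) y)) +i*
    (\int[mu]_y (K (x, y) * ((fun x => complex.Im (e x)) \_ (unitI R)) y)).
  move=> xI; rewrite /L0 /intC !(@Rintegral_mkcond _ _ _ mu (unitI R)).
  congr (_ +i* _); apply: eq_Rintegral => y _; rewrite !patchE;
    case: ifP => yI; rewrite ?mulr0// /k0
    (transfer_kernelE rho0 xI (set_mem yI));
    rewrite -[folded _ _ _]/(K (x, y)); case: (e y) => a b /=; ring.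
have [Cr HCr] : exists Cr, forall x,
    `|\int[mu]_y (K (x, y) * ((fun x => complex.Re (e x)) \_ (unitI R)) y)| <= Cr.
  by eexists => x; apply: Rintegral_kernel_le => //; exact: Lp01_2_integrable.
have [Ci HCi] : exists Ci, forall x,
    `|\int[mu]_y (K (x, y) * ((fun x => complex.Im (e x)) \_ (unitI R)) y)| <= Ci.
  by eexists => x; apply: Rintegral_kernel_le => //; exact: Lp01_2_integrable.
case: lambda l0 eE => a b l0 eE.
have ab0 : 0 < a ^+ 2 + b ^+ 2.
  rewrite lt_neqAle addr_ge0 ?sqr_ge0// andbT eq_sym paddr_eq0 ?sqr_ge0//.
  by rewrite !sqrf_eq0; move: l0; rewrite eq_complex.
(* With w = [L0 T0 rho e], a.e. equal to $\lambda e$, division by $\lambda = a + ib$ reads $e =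
   \bar\lambda w/(a^2+b^2)$; the numerator is estimated in real coordinates. *)
exists ((`|a| + `|b|) * (Cr + Ci) / (a ^+ 2 + b ^+ 2)).
apply: lebesgue_aeS eE => x ex xI; move: (ex xI); rewrite L0E//.
case: (e x) => r s /=.
have := HCr x; have := HCi x.
set wi := \int[mu]_y _; set wr := \int[mu]_y _ => wiC wrC [wrE wiE].
have bnd c c' : `|c| <= `|a| + `|b| -> `|c'| <= `|a| + `|b| ->
    `|c * wr + c' * wi| <= (`|a| + `|b|) * (Cr + Ci).
  move=> h h'; rewrite (le_trans (ler_normD _ _))// mulrDr !normrM.
  by apply: lerD; apply: ler_pM.
split; rewrite ler_pdivlMr// -[X in _ * X]ger0_norm ?(ltW ab0)// -normrM.
- have -> : r * (a ^+ 2 + b ^+ 2) = a * wr + b * wi by rewrite wrE wiE; ring.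
  by apply: bnd; rewrite ?lerDl ?lerDr.
- have -> : s * (a ^+ 2 + b ^+ 2) = (- b) * wr + a * wi by rewrite wrE wiE; ring.
  by apply: bnd; rewrite ?normrN ?lerDl ?lerDr.
Qed.

(** [G] is a measurable version of -[Ehat] defined on the whole line. The identity and the
    integrability hold at every y of [0, 1], not just almost every one, because the hypothesis on F'
    is used pointwise. The bound is conditional on $\lambda \ne 0$, a fact that is itself derived
    from the values of [G] on F'. *)
Lemma Rintegral_calP_kerE (lambda : R[i]) (e ehat : R -> R[i]) :
  is_eigenvector (L0 T0 rho) lambda e -> L2C ehat ->
  exists G : R -> R, [/\ measurable_fun setT G,
    forall y, unitI R y -> \int[mu]_(x in unitI R)
      (calP T0 rho x y * kerE lambda e ehat x y) = G y,
    forall y, unitI R y -> mu.-integrable (unitI R)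
      (fun x => (calP T0 rho x y * kerE lambda e ehat x y)%:E) &
    lambda != 0 -> exists C : R, {ae mu, forall y, unitI R y -> `|G y| <= C}].
Proof.
move=> eE [Lhr Lhi]; have [[Ler Lei] _ _] := eE.
have [M drhoM] : exists M : R, forall s, `|derive1 rho s| <= M.
  by case: rhoL => -[k kL] _ _ _; exact: derive1_lipschitz_bounded kL.
have M0 : 0 <= M by exact: le_trans (drhoM 0).
pose K p := folded (derive1 rho) p.1 (T p.2).
have mK : measurable_fun setT K.
  by apply: measurable_folded => //; exact: measurable_derive1.
have KM p : `|K p| <= 6 * M by exact: folded_bounded.
pose er := (fun x => complex.Re (e x)) \_ (unitI R).
pose ei := (fun x => complex.Im (e x)) \_ (unitI R).
pose hr := (fun x => complex.Re (ehat x)) \_ (unitI R).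
pose hi := (fun x => complex.Im (ehat x)) \_ (unitI R).
have mer : measurable_fun setT er := Lfun_measurable Ler.
have mei : measurable_fun setT ei := Lfun_measurable Lei.
have mhr : measurable_fun setT hr := Lfun_measurable Lhr.
have mhi : measurable_fun setT hi := Lfun_measurable Lhi.
pose a := complex.Re lambda; pose b := complex.Im lambda.
(* On [0, 1], [c1] and [c2] are the real and imaginary parts of $\lambda e$, and $E(x,y) =
   \Re(\overline{\hat e(x)}\,\lambda e(y))$. *)
pose c1 y := er y * a - ei y * b; pose c2 y := ei y * a + er y * b.
have mc1 : measurable_fun setT c1.
  by apply: measurable_funB; apply: measurable_funM.
have mc2 : measurable_fun setT c2.
  by apply: measurable_funD; apply: measurable_funM.
pose F (p : R * R) := K p * (hr p.1 * c1 p.2 + hi p.1 * c2 p.2).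
have mF : measurable_fun setT F.
  apply: measurable_funM => //; apply: measurable_funD; apply: measurable_funM;
    exact: measurableT_comp.
exists (fun y => \int[mu]_x F (x, y)).
have ihr : mu.-integrable setT (EFin \o hr) by exact: Lp01_2_integrable.
have ihi : mu.-integrable setT (EFin \o hi) by exact: Lp01_2_integrable.
have FE x y : unitI R x -> unitI R y ->
    F (x, y) = calP T0 rho x y * kerE lambda e ehat x y.
  move=> xI yI; rewrite /F /hr /hi /c1 /c2 /er /ei !patchE !mem_set//.
  rewrite /calP (transfer_kernelE drho0 xI yI) -[folded _ _ _]/(K (x, y)).
  by rewrite /kerE /=; ring.
split.
- exact: measurable_parametric_Rintegral.
- move=> y yI; rewrite (@Rintegral_mkcond _ _ _ mu (unitI R)).
  apply: eq_Rintegral => x _; rewrite patchE.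
  case: ifP => xI; first by rewrite FE//; exact: set_mem.
  by rewrite /F /hr /hi !patchE xI !mul0r addr0 mulr0.
- move=> y yI; apply: (@eq_integrable _ _ _ mu _ measurable_unitI
    (fun x => (F (x, y))%:E)); first by move=> x /set_mem xI; rewrite FE.
  apply: (@integrableS _ _ _ mu setT) => //; first exact: measurable_unitI.
  (* For fixed y this is a linear combination of integrable functions, and the other factor [K] is
     bounded by 6M. *)
  pose g x := hr x * c1 y + hi x * c2 y.
  have ig : mu.-integrable setT (EFin \o g).
    exact: (integrableD measurableT (integrableZr measurableT (c1 y) ihr)
      (integrableZr measurableT (c2 y) ihi)).
  apply: (le_integrable measurableT _ _
    (integrableZl measurableT (6 * M) (integrable_norm ig))).
    by apply/measurable_EFinP; exact: (measurableT_comp mF (pair2_measurable y)).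
  move=> x _ /=; rewrite lee_fin normrM.
  by rewrite [leRHS]ger0_norm ?mulr_ge0// ler_wpM2r.
- move=> l0; have [C eC] := eigenvector_ess_bounded l0 eE.
  pose N := C * (`|a| + `|b|).
  (* [N] bounds the factors [c1] and [c2] for almost every y; in x, integrability of [ehat] is
     enough. *)
  exists (\int[mu]_x (6 * M * N * (`|hr x| + `|hi x|))).
  apply: lebesgue_aeS eC => y eC yI; have [reC imC] := eC yI.
  have erC : `|er y| <= C by rewrite /er patchE mem_set.
  have eiC : `|ei y| <= C by rewrite /ei patchE mem_set.
  have c1N : `|c1 y| <= N.
    rewrite /c1 /N (le_trans (ler_normB _ _))// mulrDr !normrM.
    by apply: lerD; rewrite ler_wpM2r.
  have c2N : `|c2 y| <= N.
    rewrite /c2 /N (le_trans (ler_normD _ _))// mulrDr !normrM.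
    by apply: lerD; rewrite ler_wpM2r.
  apply: normr_Rintegral_le.
  + exact: (measurableT_comp mF (pair2_measurable y)).
  + exact: (integrableZl measurableT (6 * M * N) (integrableD measurableT
      (integrable_norm ihr) (integrable_norm ihi))).
  + move=> x; rewrite /F normrM -mulrA ler_pM//.
    rewrite (le_trans (ler_normD _ _))// [leRHS]mulrDr.
    by rewrite (normrM (hr _)) (normrM (hi _)) ![N * _]mulrC lerD// ler_wpM2l.
Qed.

End unit_interval.

(** * Minimization of a linear functional on the unit sphere *)

Section minimization.
Context {R : realType}.
Notation mu := (@lebesgue_measure R).

Lemma sqre_sub1_eq0 (x : \bar R) : (0 <= x)%E ->
  (x ^+ 2 - 1 = 0)%E <-> x = 1%E.
Proof.
move=> x0; split=> [|->]; last by rewrite -[(1 ^+ 2)%E]/(1 * 1)%E mule1 subee.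
case: x x0 => [r r0 H|_|]//.
 have /eqP : r * r - 1 = 0 := EFin_inj H.
rewrite subr_eq0 -expr2 sqrf_eq1 => /orP[/eqP ->//|/eqP r1].
by move: r0; rewrite lee_fin r1 ler0N1.
Qed.

(** Both measures are values of one outer measure, which is monotone. This turns a Borel null set
    covering F' into a contradiction with the positivity of its completed measure. *)
Lemma completed_lebesgue_measure_null (A N : set R) : A `<=` N ->
  mu N = 0%E -> completed_lebesgue_measure A = 0%E.
Proof.
move=> AN N0; apply/eqP; rewrite eq_le measure_ge0 andbT.
by rewrite -N0; exact: le_outer_measure.
Qed.

Lemma measurable_Ftilde (T0 : R -> R) l : measurable_fun (unitI R) T0 ->
  measurable (Ftilde T0 l).
Proof.
move=> mT0; rewrite [Ftilde _ _](_ : _ = unitI R `&` T0 @^-1` `[l, 1 - l]).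
  by apply: mT0; [exact: measurable_unitI|exact: measurable_itv].
by apply/seteqP; split => x /=; rewrite in_itv.
Qed.

Lemma feasible_normalized (T0 : R -> R) l (T : R -> R) : feasible T0 l T ->
  \int[mu]_x ((T \_ (unitI R)) x * (T \_ (unitI R)) x) = 1.
Proof.
by move=> [[LT _] /sqre_sub1_eq0 N1]; apply/Lnorm2_eq1/N1 => //; exact: Lnorm_ge0.
Qed.

(** To be applied with d = g/|g| and alpha = |g|. The functional h is prescribed on [Ftilde T0 l]
    only, since feasible functions vanish a.e. on the rest of [0, 1]. The objective is then -alpha
    times the inner product with d, and [Lfun2_dot_le1] settles both minimality and uniqueness. *)
Lemma unique_minimizer_linear (T0 : R -> R) l (h d : R -> R) alpha :
  measurable_fun (unitI R) T0 -> measurable_fun (unitI R) h -> 0 < alpha ->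
  d \in Lfun mu 2%:E -> (forall y, ~ Ftilde T0 l y -> d y = 0) ->
  \int[mu]_x (d x * d x) = 1 ->
  (forall y, Ftilde T0 l y -> h y = - alpha * d y) ->
  unique_minimizer (feasible T0 l) (fun T => inner2 T h) d.
Proof.
move=> mT0 mh a0 Ld d0 d1 hE.
have dI : d \_ (unitI R) = d.
  apply/funext => y; rewrite patchE; case: ifPn => // /negP yI.
  by rewrite d0// => -[] /mem_set.
have fd : feasible T0 l d.
  split; first split.
  - by rewrite /Lp01 /= dI.
  - by apply: aeW => y _ /d0.
  - by apply/sqre_sub1_eq0; rewrite /norm2 dI ?Lnorm_ge0//; exact/Lnorm2_eq1.
have JE T : feasible T0 l T ->
    inner2 T h = - alpha * \int[mu]_x ((T \_ (unitI R)) x * d x).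
  move=> [[LT TF] _]; have iTd := Lfun2_mul_integrable LT Ld.
  rewrite -RintegralZl// /inner2 (@Rintegral_mkcond _ _ _ mu (unitI R)).
  congr fine; apply: ae_eq_integral => //.
  - apply/measurable_EFinP/(measurable_restrictT _ measurable_unitI).
    apply: measurable_funM => //.
    by apply/(measurable_restrictT _ measurable_unitI); exact: Lfun_measurable LT.
  - apply/measurable_EFinP; apply: measurable_funM => //.
    by apply: measurable_funM; apply: Lfun_measurable; [exact: LT|exact: Ld].
  - apply: lebesgue_aeS TF => x TF _; rewrite !patchE; case: ifP => xI; last first.
      by rewrite mul0r mulr0.
    have [Fx|Fx] := pselect (Ftilde T0 l x); first by rewrite hE// mulrCA.
    by rewrite TF ?mul0r ?mulr0//; exact: set_mem.
have Jd : inner2 d h = - alpha by rewrite JE// dI d1 mulr1.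
split; first split=> // T fT.
- have [le1 _] := Lfun2_dot_le1 fT.1.1 Ld (feasible_normalized fT) d1.
  by rewrite Jd JE// mulNr lerN2 -[leRHS]mulr1 ler_pM2l.
(* Another minimizer T does at least as well as d, so its inner product with d is at least 1: the
   equality case applies. *)
- move=> T [fT /(_ _ fd)]; rewrite Jd JE// mulNr lerN2 -[leLHS]mulr1 ler_pM2l//.
  have [_ /[apply]] := Lfun2_dot_le1 fT.1.1 Ld (feasible_normalized fT) d1.
  by apply: lebesgue_aeS => x <- xI; rewrite patchE mem_set.
Qed.

End minimization.

Theorem theorem7p7 (R : realType) (T0 rho : R -> R) (lambda0 : R[i])
    (e ehat : R -> R[i]) (l : R) (F' : set R) :
  measurable_fun (unitI R) T0 ->
  (forall x, unitI R x -> unitI R (T0 x)) ->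
  lipschitz_density rho ->
  condA1 T0 rho ->
  largest_inner_eigenvalue (L0 T0 rho) lambda0 ->
  geometrically_simple (L0 T0 rho) lambda0 ->
  is_eigenvector (L0 T0 rho) lambda0 e ->
  is_eigenvector (L0_adj T0 rho) lambda0 ehat ->
  let E := kerE lambda0 e ehat in
  0 <= l ->
  F' `<=` Ftilde T0 l ->
  (completed_algebra_gen (@lebesgue_measure R)).-sigma.-measurable F' ->
  (0 < @completed_lebesgue_measure R F')%E ->
  (forall y, F' y ->
     ~ orth_compl (span1 (fun x => calP T0 rho x y)) (fun x => E x y)) ->
  exists alpha : R,
    [/\ 0 < alpha,
        norm2 (Tdot T0 rho E l alpha) = 1%E,
        unique_minimizer (feasible T0 l)
          (fun T => inner2 T (Ehat T0 rho E)) (Tdot T0 rho E l alpha) &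
        Lp01 +oo%E (Tdot T0 rho E l alpha)].
Proof.
pose mu := @lebesgue_measure R.
move=> mT0 T01 rhoL _ _ _ eE [Lhat _ _] E l_ge0 F'F mF' F'0 FE.
have [G [mG GE iG Gbnd]] := Rintegral_calP_kerE mT0 T01 rhoL eE Lhat.
have GF' y : F' y -> G y <> 0.
  move=> F'y G0; have [yI _] := F'F y F'y.
  apply: (FE y F'y); split.
    (* Membership in [orth_compl] includes being in $L^2$: for fixed y, $E(\cdot,y)$ is a real
       linear combination of $\Re\hat e$ and $\Im\hat e$. *)
    case: eE Lhat => -[_ _] _ _ [Lhr Lhi].
    pose a := complex.Re lambda0; pose b := complex.Im lambda0.
    pose c1 := complex.Re (e y) * a - complex.Im (e y) * b.
    pose c2 := complex.Im (e y) * a + complex.Re (e y) * b.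
    have LE := (Lfun_addr_closed mu (lee1n 2)).2 _ _
      (Lfun_scale c1 (ler1n _ 2) Lhr) (Lfun_scale c2 (ler1n _ 2) Lhi).
    rewrite /Lp01 /=; suff -> : (fun x => E x y) \_ (unitI R) =
      (c1 \o* ((fun x => complex.Re (ehat x)) \_ (unitI R))) \+
      (c2 \o* ((fun x => complex.Im (ehat x)) \_ (unitI R))) by exact: LE.
    apply/funext => x; rewrite /= !patchE; case: ifP => xI; last by rewrite !mul0r addr0.
    by rewrite /E /kerE /c1 /c2 /a /b; ring.
  move=> _ [c ->]; rewrite /inner2.
  under eq_Rintegral do rewrite mulrCA mulrC [E _ _ * _]mulrC.
  rewrite RintegralZr ?GE ?G0 ?mul0r//; first exact: measurable_unitI.
  exact: iG.
have [y0 F'y0] : exists y, F' y.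
  apply/set0P/negP => /eqP F'e; move: F'0.
  by rewrite F'e measure0 ltxx.
have l0 : lambda0 != 0.
  apply/eqP => l0; apply: (GF' y0 F'y0); rewrite -GE; last by have [] := F'F _ F'y0.
  rewrite (@eq_Rintegral _ _ _ mu (unitI R) (cst 0)) ?Rintegral_cst ?mul0r//.
    exact: measurable_unitI.
  by move=> x _; rewrite /kerE l0 /= !mulr0 addr0 mulr0.
have [C GC] := Gbnd l0.
set F := Ftilde T0 l.
have mF : measurable F by exact: measurable_Ftilde.
pose g := G \_ F.
have mg : measurable_fun setT g.
  by apply/(measurable_restrictT _ mF); exact: measurable_funTS.
have g0 y : ~ F y -> g y = 0 by move=> Fy; rewrite /g patchE memNset.
have TdotE alpha : Tdot T0 rho E l alpha = fun y => alpha^-1 * g y.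
  apply/funext => y; rewrite /Tdot /g patchE; case: ifPn => yF; last by rewrite mulr0.
  by rewrite div1r -GE//; have /set_mem[] := yF.
have FI : F `<=` unitI R by move=> y [].
have Lbnd alpha : (fun y => alpha^-1 * g y) \in Lfun mu 2%:E /\
    (fun y => alpha^-1 * g y) \in Lfun mu +oo%E.
  (* The bound must also hold where g is 0, hence |C| in place of C. *)
  apply: (@ae_bounded_Lfun _ _ _ mu (unitI R) (`|alpha^-1| * `|C|)).
  - exact: measurable_unitI.
  - exact: lebesgue_measure_unitI_fin.
  - exact: measurable_funM.
  - by move=> y yI; rewrite g0 ?mulr0// => /FI.
  - apply: lebesgue_aeS GC => y GC; rewrite normrM ler_wpM2l//.
    rewrite /g patchE; case: ifPn => yF; last by rewrite normr0.
    by rewrite (le_trans (GC _))// ?ler_norm//; apply: FI; exact: set_mem.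
have Lg : g \in Lfun mu 2%:E.
  have [] := Lbnd 1.
  by rewrite (_ : (fun y => _) = g)//; apply/funext => y; rewrite invr1 mul1r.
have igg := Lfun2_mul_integrable Lg Lg.
set S := \int[mu]_y (g y * g y).
have S0 : 0 < S.
  rewrite lt_neqAle; apply/andP; split; last first.
    by apply: Rintegral_ge0 => y _; rewrite -expr2 sqr_ge0.
  apply/negP => /eqP S0.
  have fin_gg : (\int[mu]_y (g y * g y)%:E)%E \is a fin_num.
    exact: integrable_fin_num igg.
  have : (\int[mu]_y `|(g y * g y)%:E| = 0)%E.
    under eq_integral do rewrite gee0_abs ?lee_fin -?expr2 ?sqr_ge0// expr2.
    by rewrite -(fineK fin_gg) -[fine _]/S -S0.
  move/(ae_eq_integral_abs _ measurableT (measurable_int _ igg)).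
  (* If S = 0 then g vanishes outside a Borel null set [N], and [N] contains F' because g has no
     zero there. *)
  move=> [N [mN N0 gN]]; move: F'0.
  rewrite (@completed_lebesgue_measure_null _ F' N) ?ltxx//.
  move=> y F'y; apply: gN => /= /(_ I) [] /eqP.
  rewrite mulf_eq0 orbb /g patchE mem_set; last exact: F'F.
  by move/eqP; exact: GF'.
have a0 : 0 < Num.sqrt S by rewrite sqrtr_gt0.
(* The normalizing constant is the $L^2$ norm of g. *)
exists (Num.sqrt S); rewrite TdotE; have [L2 Loo] := Lbnd (Num.sqrt S).
set d := fun y => _ in L2 Loo *.
have d0 y : ~ F y -> d y = 0 by move=> Fy; rewrite /d g0 ?mulr0.
have dI : d \_ (unitI R) = d.
  apply/funext => y; rewrite patchE; case: ifPn => // /negP yI.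
  by rewrite d0// => /FI /mem_set.
have d1 : \int[mu]_y (d y * d y) = 1.
  under eq_Rintegral do rewrite /d mulrACA -expr2 exprVn sqr_sqrtr ?(ltW S0)//.
  by rewrite RintegralZl// mulVf// gt_eqF.
split => //.
- by rewrite /norm2 dI; apply/Lnorm2_eq1.
- apply: (@unique_minimizer_linear _ _ _ _ _ (Num.sqrt S)) => //.
  + apply: (eq_measurable_fun (fun y => - G y)).
      by move=> y /set_mem yI; rewrite /Ehat GE.
    by apply: measurable_funN; exact: measurable_funTS.
  + move=> y Fy; rewrite /Ehat GE; last exact: FI.
    by rewrite /d /g patchE mem_set// mulNr mulrA divff ?mul1r// gt_eqF.
- by rewrite /Lp01 /= dI.
Qed.
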